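(* Let $\mathcal A=\{a,b,c\}$ and let $\gamma:\mathcal A^*\to\mathcal A^*$ be the morphism $\gamma(a)=aca$, $\gamma(b)=cab$, $\gamma(c)=b$. Let ${\bf x}_\gamma$ be the fixed point of $\gamma$ starting with the letter $a$. Then $\gamma$ is primitive, ${\bf x}_\gamma$ is palindromic, and no morphism $\varphi:\mathcal A^*\to\mathcal A^*$ with $\varphi({\bf x}_\gamma)={\bf x}_\gamma$ and $\varphi\neq\mathrm{Id}$ has a conjugate in class $\mathcal P$.
   Context: A morphism is a monoid morphism $\varphi:\mathcal A^*\to\mathcal A^*$ (possibly erasing); it extends naturally to right-infinite words. A morphism is primitive if there is $k$ such that for every letter $\alpha$, $\varphi^k(\alpha)$ contains every letter of $\mathcal A$. The fixed point of $\gamma$ starting with $a$ is the infinite word $\lim_n\gamma^n(a)$ (which exists since $\gamma(a)$ starts with $a$ and is longer than $a$). A right-infinite word is palindromic if its set of factors contains arbitrarily long palindromes (words equal to their reversal). A morphism $\varphi$ is in class $\mathcal P$ if there is a palindrome $p$ and, for each letter $\alpha$, a palindrome $q_\alpha$ with $\varphi(\alpha)=pq_\alpha$. For morphisms $\varphi,\varphi'$, write $\varphi\triangleleft\varphi'$ if there is a word $w$ with $\varphi(x)w=w\varphi'(x)$ for all words $x$; $\varphi$ and $\varphi'$ are conjugate if $\varphi\triangleleft\varphi'$ or $\varphi'\triangleleft\varphi$. ''$\varphi$ has a conjugate in class $\mathcal P$'' means some morphism in class $\mathcal P$ is conjugate to $\varphi$. $\mathrm{Id}$ is the identity morphism. 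*)

(* Defs.v *)
From HB Require Import structures.
From mathcomp Require Import all_boot.

Set Implicit Arguments.
Unset Strict Implicit.
Unset Printing Implicit Defensive.

Section Words.

Variable A : eqType.

Implicit Types (phi psi : seq A -> seq A) (u v w : seq A) (x y : nat -> A).

Definition palindrome w : Prop := rev w = w.

Definition is_morphism phi : Prop :=
  phi [::] = [::] /\ {morph phi : u v / u ++ v}.

Definition primitive phi : Prop :=
  exists k, forall alpha beta : A, beta \in iter k phi [:: alpha].

(* Right-infinite words are functions nat -> A; mkseq x m is the prefix of x
   of length m. The limit is necessarily infinite: if the lengths of the words
   s n stay bounded, then s converges to no x. *)
Definition converges_to (s : nat -> seq A) x : Prop :=
  forall m, exists N, forall n, N <= n -> prefix (mkseq x m) (s n).

(* phi(x) = y. If phi erases so much that phi(x) is a finite word, this holds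
   for no y. *)
Definition image_infword phi x y : Prop :=
  converges_to (fun n => phi (mkseq x n)) y.

Definition factor w x : Prop :=
  exists i, w = mkseq (fun j => x (i + j)) (size w).

Definition palindromic x : Prop :=
  forall n, exists w, [/\ factor w x, palindrome w & n <= size w].

Definition classP phi : Prop :=
  is_morphism phi /\
  exists2 p, palindrome p &
    forall alpha : A, exists2 q, palindrome q & phi [:: alpha] = p ++ q.

Definition left_conjugate phi psi : Prop :=
  exists w, forall u, phi u ++ w = w ++ psi u.

Definition conjugate phi psi : Prop :=
  left_conjugate phi psi \/ left_conjugate psi phi.

Definition has_conjugate_in_classP phi : Prop :=
  exists2 psi, classP psi & conjugate phi psi.

Definition morphism_of (f : A -> seq A) w : seq A := flatten (map f w).

Lemma morphism_ofP f : is_morphism (morphism_of f).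
Proof. by split=> // u v; rewrite /morphism_of map_cat flatten_cat. Qed.

End Words.

Inductive letter : Type := La | Lb | Lc.

Definition letter_eqb (l1 l2 : letter) : bool :=
  match l1, l2 with
  | La, La | Lb, Lb | Lc, Lc => true
  | _, _ => false
  end.

Lemma letter_eqP : Equality.axiom letter_eqb.
Proof. by do 2!case; constructor. Qed.

HB.instance Definition _ := hasDecEq.Build letter letter_eqP.

Definition gamma : seq letter -> seq letter :=
  morphism_of (fun l => match l with
                        | La => [:: La; Lc; La]
                        | Lb => [:: Lc; La; Lb]
                        | Lc => [:: Lb]
                        end).

(* The i-th letter is read off gamma^i(a), which has more than i letters;
   x_gammaP shows that this is the limit of the words gamma^n(a). *)
Definition x_gamma : nat -> letter :=
  fun i => nth La (iter i gamma [:: La]) i.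

Lemma size_gamma w : size w <= size (gamma w).
Proof.
rewrite /gamma /morphism_of; elim: w => //= l w IH; rewrite size_cat.
by apply: (@leq_add 1 _ _ _ _ IH); case: l.
Qed.

Lemma iter_gammaS n : exists2 v, 0 < size v &
  iter n.+1 gamma [:: La] = iter n gamma [:: La] ++ v.
Proof.
elim: n => [|n [v v_gt0 IH]]; first by exists [:: Lc; La].
exists (gamma v); first exact: leq_trans v_gt0 (size_gamma v).
by rewrite iterS {1}IH /gamma (morphism_ofP _).2.
Qed.

Lemma size_iter_gamma n : n < size (iter n gamma [:: La]).
Proof.
elim: n => // n IH; have [v v_gt0 ->] := iter_gammaS n.
by rewrite size_cat -(addn1 n.+1) leq_add.
Qed.

Lemma prefix_iter_gamma m n : m <= n ->
  prefix (iter m gamma [:: La]) (iter n gamma [:: La]).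
Proof.
move=> /subnK <-; elim: (n - m) => [|d IH]; first exact: prefix_refl.
have [v _ ->] := iter_gammaS (d + m).
exact: prefix_trans IH (prefix_prefix _ _).
Qed.

Lemma x_gammaP : converges_to (fun n => iter n gamma [:: La]) x_gamma.
Proof.
move=> m; exists m => n le_mn.
have size_n := leq_ltn_trans le_mn (size_iter_gamma n).
rewrite prefixE size_mkseq; apply/eqP/(@eq_from_nth _ La).
  by rewrite size_takel ?size_mkseq // ltnW.
rewrite size_takel ?(ltnW size_n) // => i lt_im.
rewrite nth_take // nth_mkseq // /x_gamma.
have /prefixP[v ->] := prefix_iter_gamma (leq_trans (ltnW lt_im) le_mn).
by rewrite nth_cat size_iter_gamma.
Qed.

(* Main.v *)
(* The letter a occupies every other position of x: deleting it and writing
   false for c, true for b turns x into the fixed point y of the morphism psi,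
   psi(c) = cb, psi(b) = ccb. A morphism phi fixing x induces a morphism fixing
   y, which is a power of psi: as long as it is not the identity, both images
   end at the end of a psi-block (the prefix cbccb of y is always preceded by
   b), so psi can be factored out. Hence phi(ac) = gamma^n(ac) and
   phi(ab) = gamma^n(ab) for some n, and only the cut phi(a) is free.

   If phi has a conjugate p q_x in class P, then phi is conjugated to its
   reversal by a palindrome W of the same parity as p. On the other hand
   psi^n(c) = c B with B a palindrome conjugating psi^n to its reversal.
   Conjugating words are unique because psi^n(b) and psi^n(c) do not commute;
   this forces W = rev(phi(a)) D, where aD is the spelling of B. If phi(a) is
   empty, then p is empty although W has odd length. Otherwise phi(a) spells a
   nonempty common prefix u of psi^n(b) and psi^n(c) such that B u is a
   palindrome, which is excluded by removing psi repeatedly. *)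

Require Import Defs.
From mathcomp Require Import all_boot.

Set Implicit Arguments.
Unset Strict Implicit.
Unset Printing Implicit Defensive.

(** * Commutation and conjugacy of words *)

Section WordCombinatorics.

Variable T : eqType.
Implicit Types (u v w x y z : seq T).

Lemma prefix_catr_size u v w : prefix u (v ++ w) -> size u <= size v -> prefix u v.
Proof. by move=> + le_uv; rewrite !prefixE takel_cat. Qed.

Lemma prefix_comparable u v w :
  prefix u w -> prefix v w -> size u <= size v -> prefix u v.
Proof. by move=> /[swap] /prefixP[t ->]; exact: prefix_catr_size. Qed.

Lemma size_flatten_nseq k x : size (flatten (nseq k x)) = k * size x.
Proof. by elim: k => //= k IH; rewrite size_cat IH mulSn. Qed.

Lemma commute_prefix_power z x : z != [::] -> z ++ x = x ++ z ->
  forall k, size x <= k -> prefix x (flatten (nseq k z)).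
Proof.
move=> z_neq0 comm k le_xk.
have comm_k : flatten (nseq k z) ++ x = x ++ flatten (nseq k z).
  elim: {le_xk}k => [|k IH] /=; first by rewrite cats0.
  by rewrite -catA IH catA comm -catA.
apply: (@prefix_catr_size _ _ x); first by rewrite comm_k prefix_prefix.
rewrite size_flatten_nseq (leq_trans le_xk) // leq_pmulr //.
by rewrite lt0n size_eq0.
Qed.

(** Both products commute with [z] and have the same length, so they are the same prefix of a power
    of [z]. *)
Lemma commute_trans z x y : z != [::] ->
  z ++ x = x ++ z -> z ++ y = y ++ z -> x ++ y = y ++ x.
Proof.
move=> z_neq0 comm_x comm_y.
have pow (s t : seq T) : z ++ s = s ++ z -> z ++ t = t ++ z ->
    s ++ t = take (size s + size t) (flatten (nseq (size s + size t) z)).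
  move=> comm_s comm_t; apply/esym/eqP; rewrite -size_cat -prefixE.
  apply: commute_prefix_power => //.
  by rewrite catA comm_s -catA comm_t catA.
by rewrite (pow x y) // (pow y x) // addnC.
Qed.

Lemma conjugator_prefix w x y : w ++ x = y ++ w -> y != [::] ->
  forall k, size w <= k -> prefix w (flatten (nseq k y)).
Proof.
move=> wx y_neq0 k le_wk.
have iter_conj : w ++ flatten (nseq k x) = flatten (nseq k y) ++ w.
  elim: {le_wk}k => [|k IH] /=; first by rewrite cats0.
  by rewrite catA wx -!catA IH.
apply: (@prefix_catr_size _ _ w); first by rewrite -iter_conj prefix_prefix.
rewrite size_flatten_nseq (leq_trans le_wk) // leq_pmulr //.
by rewrite lt0n size_eq0.
Qed.

(** Both conjugators are prefixes of powers of [y1], so one extends the other by some [z] commuting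
    with [x1] and [x2], which must then be empty. *)
Lemma conjugator_unique v w x1 x2 y1 y2 : y1 != [::] ->
  v ++ x1 = y1 ++ v -> w ++ x1 = y1 ++ w ->
  v ++ x2 = y2 ++ v -> w ++ x2 = y2 ++ w ->
  x1 ++ x2 <> x2 ++ x1 -> v = w.
Proof.
move=> y1_neq0; wlog le_wv : v w / size w <= size v => [IH vx1 wx1 vx2 wx2 nc|].
  by case: (leqP (size w) (size v)) => [|/ltnW] le; [|apply/esym]; exact: IH.
move=> vx1 wx1 vx2 wx2 ncomm.
have v_pref := conjugator_prefix vx1 y1_neq0 (leqnn _).
have w_pref := conjugator_prefix wx1 y1_neq0 le_wv.
have /prefixP[z v_eq] := prefix_comparable w_pref v_pref le_wv.
have comm x y : v ++ x = y ++ v -> w ++ x = y ++ w -> z ++ x = x ++ z.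
  rewrite v_eq catA => /[swap] <-; rewrite -!catA => /eqP.
  by rewrite eqseq_cat // eqxx => /eqP.
have [z_eq0|z_neq0] := eqVneq z [::]; first by rewrite v_eq z_eq0 cats0.
by case: ncomm; exact: commute_trans z_neq0 (comm _ _ vx1 wx1) (comm _ _ vx2 wx2).
Qed.

(** These are the two reduced forms of v^-1 p rev(v)^-1 in the free group: [r] in the first case,
    its inverse in the second. *)
Lemma palindrome_cat p t v : palindrome p -> p = v ++ t ->
  (exists2 r, palindrome r & p = v ++ r ++ rev v) \/
  (exists2 r, palindrome r & v = rev t ++ r).
Proof.
rewrite /palindrome => + p_eq; rewrite p_eq rev_cat => p_pal.
case: (leqP (size v) (size t)) => [le_vt|/ltnW le_tv]; [left|right].
  have t_eq : t = take (size t - size v) t ++ rev v.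
    rewrite -{1}(cat_take_drop (size t - size v) t); congr (_ ++ _).
    have := congr1 (drop (size t)) p_pal.
    rewrite drop_size_cat ?size_rev // drop_cat ltnNge le_vt /=.
    by move=> ->.
  move: p_pal; rewrite t_eq !rev_cat revK -!catA => /eqP.
  rewrite eqseq_cat // eqxx eqseq_cat ?size_rev // eqxx andbT => /eqP r_pal.
  by eexists; first exact: r_pal.
have v_eq : v = rev t ++ drop (size t) v.
  rewrite -{1}(cat_take_drop (size t) v); congr (_ ++ _).
  have := congr1 (take (size t)) p_pal.
  by rewrite take_size_cat ?size_rev // takel_cat.
exists (drop (size t) v) => //.
move: p_pal; rewrite {1 2}v_eq rev_cat revK -catA => /eqP.
by rewrite eqseq_cat // eqxx /= eqseq_cat ?size_rev // eqxx andbT => /eqP.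
Qed.

Lemma morphism_nseq (phi : seq T -> seq T) : is_morphism phi ->
  forall k u, phi (flatten (nseq k u)) = flatten (nseq k (phi u)).
Proof.
by move=> [phi0 phiM]; elim=> [|k IH] u //=; rewrite phiM IH.
Qed.

(* If [psi (x) = p q_x] then [p rev (psi (x)) = psi (x) p]; the conjugator [w]
   transports this relation to [phi], the conjugating word being
   [w p rev (w)] or [w^-1 p rev (w)^-1], reduced in the free group. *)
Lemma classP_conjugate_rev (phi psi : seq T -> seq T) p :
    is_morphism psi -> palindrome p ->
    (forall x : T, exists2 q, palindrome q & psi [:: x] = p ++ q) ->
    conjugate phi psi -> (exists x : T, phi [:: x] != [::]) ->
  exists W, [/\ palindrome W, odd (size W) = odd (size p) &
    (forall x : T, phi [:: x] ++ W = W ++ rev (phi [:: x])) \/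
    (forall x : T, W ++ phi [:: x] = rev (phi [:: x]) ++ W)].
Proof.
rewrite /palindrome => psiM p_pal psi_pq [[w wE]|[w wE]] phi_neq0.
  exists (w ++ p ++ rev w); split.
  - by rewrite !rev_cat revK p_pal catA.
  - by rewrite !size_cat size_rev addnCA oddD addnn odd_double addbF.
  left=> x; have [q q_pal psi_x] := psi_pq x.
  have := wE [:: x]; rewrite psi_x => phiw.
  have := congr1 rev phiw; rewrite !rev_cat p_pal q_pal => wphi.
  by rewrite catA phiw -!catA wphi !catA.
have [x phix_neq0] := phi_neq0.
have psix_neq0 : psi [:: x] != [::].
  have /(congr1 size) := wE [:: x]; rewrite !size_cat addnC => /addnI sz.
  by rewrite -size_eq0 sz size_eq0.
pose k := (size w + size p).+1.
have le_k : size w + size p < size (flatten (nseq k (psi [:: x]))).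
  by rewrite size_flatten_nseq leq_pmulr // lt0n size_eq0.
have w_pref : prefix w (flatten (nseq k (psi [:: x]))).
  apply: (@prefix_catr_size _ _ w); last exact: leq_trans (leq_addr _ _) (ltnW le_k).
  by rewrite -morphism_nseq // wE prefix_prefix.
have p_pref : prefix p (flatten (nseq k (psi [:: x]))).
  by have [q _ ->] := psi_pq x; rewrite /= -catA prefix_prefix.
case: (leqP (size p) (size w)) => [le_pw|/ltnW le_wp].
  have /prefixP[v w_eq] := prefix_comparable p_pref w_pref le_pw.
  (* Here w^-1 p rev(w)^-1 reduces to the inverse of this palindrome, so the relation changes
     sides. *)
  exists (rev v ++ p ++ v); split.
  - by rewrite !rev_cat revK p_pal catA.
  - by rewrite !size_cat size_rev addnCA oddD addnn odd_double addbF.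
  right=> z; have [q q_pal psi_z] := psi_pq z.
  have := wE [:: z]; rewrite psi_z w_eq -!catA => /eqP.
  rewrite eqseq_cat // eqxx => /eqP vphi.
  have := congr1 rev vphi; rewrite !rev_cat p_pal q_pal -!catA => phiv.
  by rewrite -vphi [RHS]catA -phiv -!catA.
have /prefixP[t p_eq] := prefix_comparable w_pref p_pref le_wp.
have [[r r_pal pE]|[r r_pal w_eq]] := palindrome_cat p_pal p_eq.
  exists r; split=> //.
    by rewrite pE !size_cat size_rev addnCA oddD addnn odd_double addbF.
  left=> z; have [q q_pal psi_z] := psi_pq z.
  have := wE [:: z]; rewrite psi_z pE -!catA => /eqP.
  rewrite eqseq_cat // eqxx => /eqP <-.
  by rewrite !rev_cat revK q_pal r_pal -!catA.
exists r; split=> //.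
  by rewrite p_eq w_eq !size_cat size_rev addnAC oddD addnn odd_double.
right=> z; have [q q_pal psi_z] := psi_pq z.
have := wE [:: z]; rewrite psi_z p_eq w_eq -!catA => /eqP.
rewrite eqseq_cat // eqxx eqseq_cat // eqxx => /eqP <-.
by rewrite !rev_cat !revK q_pal r_pal -!catA.
Qed.

End WordCombinatorics.

(** * The binary fixed point and its stabilizer *)

(* [false] stands for the letter c and [true] for b; y is the fixed point of
   [psi] starting with [false]. *)
Definition psi : seq bool -> seq bool :=
  morphism_of (fun t => if t then [:: false; false; true] else [:: false; true]).

Definition prefix_y u : Prop := exists n, prefix u (iter n psi [:: false]).

Lemma psi_cons t u :
  psi (t :: u) = (if t then [:: false; false; true] else [:: false; true]) ++ psi u.
Proof. by []. Qed.

Lemma psi_cat u v : psi (u ++ v) = psi u ++ psi v.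
Proof. exact: (morphism_ofP _).2. Qed.

Lemma iter_psi_cat n u v : iter n psi (u ++ v) = iter n psi u ++ iter n psi v.
Proof. by elim: n => //= n ->; rewrite psi_cat. Qed.

Lemma psi_rcons u t : psi (rcons u t) =
  rcons (psi u ++ if t then [:: false; false] else [:: false]) true.
Proof. by rewrite -cats1 psi_cat -cats1 -catA; case: t. Qed.

Lemma psi_prefix u v : prefix (psi u) (psi v) = prefix u v.
Proof. by elim: u v => [|[] u IH] [|[] v] //=; rewrite ?psi_cons ?prefix0s /= ?IH. Qed.

Lemma psi_inj : injective psi.
Proof.
move=> u v uv; have : prefix u v && prefix v u.
  by rewrite -(psi_prefix u v) -(psi_prefix v u) uv prefix_refl.
move=> /andP[/prefixP[s ->]] /prefixP[t /(congr1 size)/eqP].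
rewrite !size_cat -addnA -{1}(addn0 (size u)) eqn_add2l eq_sym addn_eq0.
by rewrite size_eq0 => /andP[/eqP->]; rewrite cats0.
Qed.

Lemma iter_psi_inj n : injective (iter n psi).
Proof. by elim: n => [|n IH] u v //= /psi_inj/IH. Qed.

(* The images of letters under [psi] end with their unique [true], so every
   [true] marks the end of a block. *)
Lemma psi_prefix_rcons u v : prefix (rcons u true) (psi v) ->
  exists2 w, rcons u true = psi w & prefix w v.
Proof.
elim: v u => [|[] v IH] u; first by case: u.
  rewrite psi_cons; case: u => [|[] [|[] [|[] u]]] //=.
    by exists [:: true] => //; rewrite /= prefix0s.
  by move=> /IH[w w_eq w_v]; exists (true :: w); rewrite ?psi_cons -?w_eq.
rewrite psi_cons; case: u => [|[] [|[] u]] //=.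
  by exists [:: false] => //; rewrite /= prefix0s.
by move=> /IH[w w_eq w_v]; exists (false :: w); rewrite ?psi_cons -?w_eq.
Qed.

Lemma psi_rcons_false u v : rcons u false <> psi v.
Proof.
case/lastP: v => [|v t]; first by case: u.
by rewrite psi_rcons => /rcons_inj[].
Qed.

Lemma psi_cat_split u v w : psi u ++ v = psi w -> exists2 z, v = psi z & w = u ++ z.
Proof.
move=> uvw; have /prefixP[z w_eq] : prefix u w.
  by rewrite -psi_prefix -uvw prefix_prefix.
exists z => //; move: uvw; rewrite w_eq psi_cat => /eqP.
by rewrite eqseq_cat // eqxx => /eqP.
Qed.

Lemma prefix_y_prefix u v : prefix u v -> prefix_y v -> prefix_y u.
Proof. by move=> uv [n vn]; exists n; exact: prefix_trans uv vn. Qed.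

Lemma prefix_iter_psi n : prefix (iter n psi [:: false]) (iter n.+1 psi [:: false]).
Proof. by rewrite iterSr -[psi _]/([:: false] ++ [:: true]) iter_psi_cat prefix_prefix. Qed.

Lemma prefix_iter_psi_le m n : m <= n ->
  prefix (iter m psi [:: false]) (iter n psi [:: false]).
Proof.
move=> /subnK <-; elim: (n - m) => [|d IH]; first exact: prefix_refl.
exact: prefix_trans IH (prefix_iter_psi _).
Qed.

Lemma prefix_y_comparable u v : prefix_y u -> prefix_y v -> size u <= size v ->
  prefix u v.
Proof.
move=> [m um] [n vn]; apply: (@prefix_comparable _ _ _ (iter (maxn m n) psi [:: false])).
- exact: prefix_trans um (prefix_iter_psi_le (leq_maxl _ _)).
- exact: prefix_trans vn (prefix_iter_psi_le (leq_maxr _ _)).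
Qed.

Lemma prefix_y_psi u : prefix_y (psi u) <-> prefix_y u.
Proof.
split=> [[n un]|[n un]].
  by exists n; rewrite -psi_prefix (prefix_trans un) // prefix_iter_psi.
by exists n.+1; rewrite iterS psi_prefix.
Qed.

Lemma prefix_y_rcons u : prefix_y (rcons u true) ->
  exists2 v, rcons u true = psi v & prefix_y v.
Proof.
move=> [n un]; have := prefix_trans un (prefix_iter_psi n).
by move=> /psi_prefix_rcons[w w_eq w_n]; exists w => //; exists n.
Qed.

(** Each [true] ends a block, so the second one would be a block by itself. *)
Lemma prefix_y_no_true_true u : ~ prefix_y (u ++ [:: true; true]).
Proof.
rewrite -cat_rcons cats1 => Py.
have [v v_eq _] := prefix_y_rcons Py.
have : prefix_y (rcons u true).
  by apply: prefix_y_prefix Py; exact: prefix_rcons.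
move=> /prefix_y_rcons[w w_eq _]; move: v_eq; rewrite w_eq -cats1.
by move=> /psi_cat_split[[|[] z] ].
Qed.

Lemma prefix_y_no_falses u : ~ prefix_y (u ++ [:: false; false; false]).
Proof.
move=> [n un]; have {un} := prefix_trans un (prefix_iter_psi n).
rewrite iterS; move: (iter n psi _) => v.
elim: v u => [|t v IH] u; first by case: u => [|? []].
rewrite psi_cons; case: t; case: u => [|[] [|[] [|[] u]]] //=.
- exact: IH.
- exact: (IH [::]).
- exact: (IH (true :: u)).
- exact: (IH (false :: u)).
Qed.

(** This is psi^2(c) = cbccb. *)
Definition y5 := [:: false; true; false; false; true].

Lemma prefix_y5 w : prefix_y w -> 4 < size w -> prefix y5 w.
Proof.
by move=> Pw sz; apply: (prefix_y_comparable _ Pw) => //; exists 2; apply: prefix_refl.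
Qed.

(* Preceded by [false], the word [y5] would decode to [true; true]. *)
Lemma before_y5 u t : prefix_y (rcons u t ++ y5) -> t = true.
Proof.
case: t => // Py.
have [v v_eq Pv] : exists2 v, rcons (u ++ [:: false; false; true; false; false]) true = psi v
      & prefix_y v.
  by apply: prefix_y_rcons; move: Py; rewrite -!cats1 -!catA.
have [w w_eq _] : exists2 w, rcons (u ++ [:: false; false]) true = psi w & prefix_y w.
  apply: prefix_y_rcons; apply: prefix_y_prefix Py;
  by rewrite -!cats1 -!catA prefix_catr // eqxx.
move: v_eq; rewrite -[_ ++ _]/(u ++ [:: false; false] ++ [:: true; false; false]).
rewrite catA -cat_rcons w_eq -cats1 -catA => /psi_cat_split[z z_eq v_eq].
have {}z_eq : z = [:: true] by case: z z_eq v_eq => [|[] [|[] z]].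
case/lastP: w => [|w t] in w_eq v_eq *; first by case: u w_eq {Py}.
(* A last letter b of [w] gives bb in y; a last letter c would leave an image of [psi] ending in
   [false]. *)
move: w_eq; rewrite psi_rcons => /rcons_inj[]; case: t v_eq => v_eq.
  by case: (@prefix_y_no_true_true w); rewrite -cat_rcons -z_eq -v_eq.
by rewrite cats1 -cat_rcons cats1 => /rcons_inj[/psi_rcons_false].
Qed.

Definition subst (w0 w1 : seq bool) : seq bool -> seq bool :=
  morphism_of (fun t : bool => if t then w1 else w0).

Lemma subst_cat w0 w1 u v : subst w0 w1 (u ++ v) = subst w0 w1 u ++ subst w0 w1 v.
Proof. exact: (morphism_ofP _).2. Qed.

Lemma subst_cons w0 w1 t u : subst w0 w1 (t :: u) = (if t then w1 else w0) ++ subst w0 w1 u.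
Proof. by []. Qed.

Lemma subst_psi w0 w1 u : subst (psi w0) (psi w1) u = psi (subst w0 w1 u).
Proof. by elim: u => // -[] u IH; rewrite !subst_cons psi_cat IH. Qed.

Lemma count_psi u :
  (size u <= count_mem false (psi u)) /\ count_mem true (psi u) = size u.
Proof.
elim: u => // t u [IH1 IH2]; rewrite psi_cons !count_cat IH2; split; last by case: t.
by rewrite -[size (_ :: _)]/(1 + size u) leq_add //; case: t.
Qed.

Lemma ltn_size_psi u : u != [::] -> size u < size (psi u).
Proof.
have le_size v : size v <= size (psi v).
  by elim: v => // -[] v IH; rewrite psi_cons size_cat (@leq_add 1).
by case: u => // t u _; rewrite psi_cons size_cat (@leq_add 2) //; case: t.
Qed.

Lemma prefix_y_of_size k : exists2 u, prefix_y u & size u = k.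
Proof.
have: k <= size (iter k psi [:: false]).
  elim: k => // k IH; rewrite iterS.
  apply: leq_ltn_trans IH (ltn_size_psi _); rewrite -size_eq0 -lt0n.
  exact: size_prefix (prefix_iter_psi_le (leq0n k)).
move=> le_k; exists (take k (iter k psi [:: false])); last exact: size_takel.
by exists k; apply: prefix_take.
Qed.

(** By descent: the powers following [w] start with [y5], so [w] ends with [true] and is the image
    of a shorter word with the same property. *)
Lemma y_aperiodic w : w != [::] -> ~ forall k, prefix_y (flatten (nseq k w)).
Proof.
have [n] := ubnP (size w); elim: n w => // n IH w le_wn w_neq0 Pw.
have w_gt0 : 0 < size w by rewrite lt0n size_eq0.
have [z w_eq] : exists z, w = psi z.
  case/lastP: w {IH le_wn} => // u t in w_neq0 w_gt0 Pw *.
  have P5 : prefix_y (flatten (nseq 5 (rcons u t))) := Pw 5.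
  have P6 : prefix_y (rcons u t ++ flatten (nseq 5 (rcons u t))) := Pw 6.
  have : prefix y5 (flatten (nseq 5 (rcons u t))).
    by apply: prefix_y5; rewrite // size_flatten_nseq leq_pmulr.
  move=> /prefixP[s s_eq]; have t1 : t = true.
    apply: (@before_y5 u); apply: prefix_y_prefix P6.
    by rewrite s_eq catA prefix_prefix.
  by have := Pw 1; rewrite /= cats0 t1 => /prefix_y_rcons[z -> _]; exists z.
apply: (IH z).
- apply: leq_trans (le_wn : size w <= n); rewrite w_eq ltn_size_psi //.
  by apply: contraNneq w_neq0; rewrite w_eq => ->.
- by apply: contraNneq w_neq0; rewrite w_eq => ->.
move=> k; apply/prefix_y_psi; have := Pw k; rewrite w_eq.
by rewrite -(@morphism_nseq _ psi (morphism_ofP _)).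
Qed.


(** If one letter is erased, prefixes of y are mapped to arbitrarily high powers of the other image,
    against aperiodicity. *)
Lemma y_no_erasing w0 w1 : (forall u, prefix_y u -> prefix_y (subst w0 w1 u)) ->
  w0 ++ w1 != [::] -> w0 != [::] /\ w1 != [::].
Proof.
move=> Pg g_neq0.
have count_power k : exists2 u, prefix_y u &
    k <= count_mem false u /\ k <= count_mem true u.
  have [u Pu szu] := prefix_y_of_size k; exists (psi u); first exact/prefix_y_psi.
  by have [] := count_psi u; rewrite szu => ? ->.
have prefix_power v m k : k <= m ->
    prefix (flatten (nseq k v)) (flatten (nseq m v)).
  move=> /subnKC <-; rewrite nseqD flatten_cat; exact: prefix_prefix.
have erase0 v u : subst [::] v u = flatten (nseq (count_mem true u) v).
  by elim: u => // -[] u IH; rewrite subst_cons IH.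
have erase1 v u : subst v [::] u = flatten (nseq (count_mem false u) v).
  by elim: u => // -[] u IH; rewrite subst_cons IH.
split; apply/eqP => w_eq0.
  apply: (@y_aperiodic w1) => [|k]; first by move: g_neq0; rewrite w_eq0.
  have [u Pu [_ le_k]] := count_power k.
  by apply: prefix_y_prefix (Pg u Pu); rewrite w_eq0 erase0 prefix_power.
apply: (@y_aperiodic w0) => [|k]; first by move: g_neq0; rewrite w_eq0 cats0.
have [u Pu [le_k _]] := count_power k.
by apply: prefix_y_prefix (Pg u Pu); rewrite w_eq0 erase1 prefix_power.
Qed.

(* If [w1] were longer, it would be [true :: psi K], and factoring [psi] out of
   the morphism applied to [psi u] gives the morphism sending each letter [t]
   to [t :: K] with [K] starting with [true]: then [true; true] occurs in y. *)
Lemma y_morphism_false w1 : (forall u, prefix_y u -> prefix_y (subst [:: false] w1 u)) ->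
  w1 != [::] -> w1 = [:: true].
Proof.
move=> Pg w1_neq0.
have P3 : prefix_y [:: false; true; false; false; true] by exists 2; apply: prefix_refl.
have Pw := Pg _ P3; rewrite /subst /morphism_of /= cats0 in Pw.
have w1_true : exists w, w1 = true :: w.
  have P2 : prefix_y [:: false; true] by exists 1; apply: prefix_refl.
  case: w1 {Pg} w1_neq0 Pw => // t w _; case: t => [|Pw]; first by exists w.
  have := prefix_y_comparable P2 Pw; rewrite /= => /(_ isT).
  by [].
have [w w1_eq] := w1_true; case/lastP: w => // w t in w1_eq *; exfalso.
have {Pw} Pw : prefix_y (false :: rcons (true :: w) t ++ [:: false; false]).
  by apply: prefix_y_prefix Pw; rewrite w1_eq /= prefix_catr // eqxx.
(* In the image of [y5], the first [w1] is followed by cc; if it ended in c, then ccc would occur in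
   y. *)
case: t => [|] in w1_eq Pw *; last first.
  apply: (@prefix_y_no_falses [:: false, true & w]).
  by move: Pw; rewrite /= -cats1 -catA.
have [v v_eq _] : exists2 v, rcons [:: false, true & w] true = psi v & prefix_y v.
  by apply: prefix_y_rcons; apply: prefix_y_prefix Pw; rewrite -cat_cons prefix_prefix.
have [K K_eq] : exists K, rcons w true = psi K.
  case: v v_eq => [|[] v] //; rewrite psi_cons /= => -[->]; by exists v.
have PK u : prefix_y u -> prefix_y (subst (false :: K) (true :: K) u).
  move=> /prefix_y_psi/Pg Pu; apply/prefix_y_psi.
  congr prefix_y: Pu; rewrite w1_eq -[true :: rcons _ _]/(true :: rcons w true) K_eq.
  by elim: u => // -[] u IH; rewrite psi_cons subst_cat IH subst_cons psi_cat /= cats0.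
have P2 := PK _ P3; rewrite /subst /morphism_of /= in P2.
have [K' K'_eq] : exists K', K = true :: K'.
  have : prefix [:: false; true] (false :: K ++ [:: true]).
    apply: prefix_y_comparable; first by exists 1; apply: prefix_refl.
      by apply: prefix_y_prefix P2; rewrite /= prefix_catr // eqxx /= prefix0s.
    by case: (K) K_eq => //; case: (w).
  case: (K) K_eq => [|[] K'] //; first by case: (w).
  by exists K'.
apply: (@prefix_y_no_true_true (false :: K)); apply: prefix_y_prefix P2.
by rewrite K'_eq /= prefix_catr // eqxx /= prefix0s.
Qed.

(** By induction on the total length of the images. Unless [w0] is c, the image of cbc has length at
    least 5 and starts with [y5]. Both letters occur just before some cbc in y, so both images end
    in b and [psi] factors out. *)
Theorem y_stabilizer w0 w1 : (forall u, prefix_y u -> prefix_y (subst w0 w1 u)) ->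
    w0 ++ w1 != [::] ->
  exists n, w0 = iter n psi [:: false] /\ w1 = iter n psi [:: true].
Proof.
have [n] := ubnP (size w0 + size w1); elim: n w0 w1 => // n IH w0 w1 le_n Pg g_neq0.
have [w0_neq0 w1_neq0] := y_no_erasing Pg g_neq0.
have P_iter k : prefix_y (iter k psi [:: false]) by exists k; apply: prefix_refl.
have [w0_eq|w0_neqF] := eqVneq w0 [:: false].
  exists 0; split=> //=; apply: y_morphism_false w1_neq0; by rewrite -w0_eq.
have w0_false : exists2 w, w0 = false :: w & w != [::].
  have : prefix_y (w0 ++ w1).
    by have := Pg _ (P_iter 1); rewrite /subst /morphism_of /= cats0.
  case: w0 {IH Pg le_n g_neq0} w0_neq0 w0_neqF => // t [|s w] _ //=.
    case: t => // _ Pw.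
    have /prefixP[] := prefix_y_comparable (P_iter 0) Pw isT; by [].
  move=> _ Pw; have /prefixP[? [<- _]] := prefix_y_comparable (P_iter 0) Pw isT.
  by exists (s :: w).
have Pg3 : prefix y5 (subst w0 w1 [:: false; true; false]).
  apply: prefix_y5.
    by apply: Pg; apply: prefix_y_prefix (P_iter 2); exact: isT.
  rewrite /subst /morphism_of /= cats0 !size_cat.
  have [w -> ] := w0_false; rewrite -size_eq0 -lt0n => w_gt0.
  rewrite -size_eq0 -lt0n in w1_neq0.
  by apply: (@leq_add 2 3 _ _ _ (@leq_add 1 2 _ _ _ _)).
have before_g u t v : prefix_y (u ++ [:: false; true; false]) ->
    subst w0 w1 u = rcons v t -> t = true.
  move=> /Pg; rewrite subst_cat => + u_eq; rewrite u_eq => Pv.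
  apply: (@before_y5 v); apply: prefix_y_prefix Pv.
  by case/prefixP: Pg3 => s ->; rewrite catA prefix_prefix.
have [v0 w0_eq] : exists v, w0 = rcons v true.
  case/lastP: w0 {IH Pg le_n g_neq0 w0_neqF Pg3 w0_false} w0_neq0 before_g.
    by [].
  move=> v t _ before_g.
  exists v; congr rcons.
  (* In y the prefix cbc is followed by cbc, and so is [y5]; the first ends in c, the second in
     b. *)
  apply: (before_g [:: false; true; false] _ (rcons v t ++ w1 ++ v)).
    by apply: prefix_y_prefix (P_iter 3).
  by rewrite /subst /morphism_of /= cats0 -!rcons_cat.
have [v1 w1_eq] : exists v, w1 = rcons v true.
  case/lastP: w1 {IH Pg le_n g_neq0 Pg3} w1_neq0 before_g => // v t _ before_g.
  exists v; congr rcons.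
  apply: (before_g y5 _ (w0 ++ rcons v t ++ w0 ++ w0 ++ v)).
    by apply: prefix_y_prefix (P_iter 3).
  by rewrite /subst /morphism_of /= cats0 -!rcons_cat.
have Pw0 : prefix_y w0 by have := Pg _ (P_iter 0); rewrite /subst /morphism_of /= cats0.
have Pw1 : prefix_y (w0 ++ w1).
  by have := Pg _ (P_iter 1); rewrite /subst /morphism_of /= cats0.
have [z0 z0_eq _] : exists2 z, w0 = psi z & prefix_y z.
  by rewrite w0_eq in Pw0 *; apply: prefix_y_rcons.
have [z1 z1_eq] : exists z, w1 = psi z.
  rewrite w1_eq -rcons_cat in Pw1; have [z] := prefix_y_rcons Pw1.
  by rewrite rcons_cat -w1_eq z0_eq => /psi_cat_split[z1 ->] _ _; exists z1.
have z0_neq0 : z0 != [::] by apply: contraNneq w0_neq0; rewrite z0_eq => ->.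
have z1_neq0 : z1 != [::] by apply: contraNneq w1_neq0; rewrite z1_eq => ->.
have [|||k [z0_k z1_k]] := IH z0 z1.
- apply: leq_trans (_ : size w0 + size w1 <= n) => //.
  by rewrite z0_eq z1_eq -addSn leq_add ?ltn_size_psi // ltnW ?ltn_size_psi.
- by move=> u /Pg; rewrite z0_eq z1_eq subst_psi => /prefix_y_psi.
- by case: (z0) z0_neq0.
by exists k.+1; rewrite z0_eq z1_eq z0_k z1_k.
Qed.

(** * Reversal of the powers of psi *)

(** The word B with psi^n(c) = c B. *)
Definition tail_y n := behead (iter n psi [:: false]).

Lemma iter_psi_false n : iter n psi [:: false] = false :: tail_y n.
Proof.
have /prefixP[s s_eq] := prefix_iter_psi_le (leq0n n).
by rewrite /tail_y s_eq.
Qed.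

Lemma tail_yS n : tail_y n.+1 = true :: psi (tail_y n).
Proof. by rewrite /tail_y iterS iter_psi_false. Qed.

Lemma leq_size_tail_y n : n <= size (tail_y n).
Proof.
elim: n => // n IH; rewrite tail_yS ltnS (leq_trans IH) //.
by case: (tail_y n) => // t u; apply/ltnW/ltn_size_psi.
Qed.

(** Each block is a palindrome followed by b, so the word b conjugates [psi] to its reversal. *)
Lemma true_psi_rev u : true :: psi u = rcons (rev (psi (rev u))) true.
Proof.
elim: u => // t u IH; rewrite psi_cons rev_cons -[rcons (rev u) t]cats1.
rewrite psi_cat rev_cat rcons_cat -IH.
by case: t.
Qed.

Lemma tail_y_palindrome n : palindrome (tail_y n).
Proof.
rewrite /palindrome; elim: n => // n IH.
by rewrite tail_yS rev_cons -{1}IH -true_psi_rev.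
Qed.

Lemma tail_y_conj n u :
  tail_y n ++ iter n psi u = rev (iter n psi (rev u)) ++ tail_y n.
Proof.
elim: n => [|n IH]; first by rewrite /= cats0 revK.
rewrite tail_yS 2!iterS cat_cons -psi_cat IH true_psi_rev rev_cat revK psi_cat.
by rewrite rev_cat rcons_cat -true_psi_rev.
Qed.

(** By descent on [n]: the first letter b of [tail_y n.+1] forces [u] to end in b, so [u] is an
    image and [true_psi_rev] carries the palindrome down one level. At level 0 the words c and b
    have no common nonempty prefix. *)
Lemma tail_y_cat_not_palindrome n u : u != [::] ->
  prefix u (iter n psi [:: false]) -> prefix u (iter n psi [:: true]) ->
  ~ palindrome (tail_y n ++ u).
Proof.
rewrite /palindrome; elim: n u => [|n IH] u u_neq0; first by case: u u_neq0 => [|[]].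
case/lastP: u => // u t in u_neq0 *.
rewrite tail_yS !iterS => pre0 pre1 pal.
have t1 : t = true by move: pal; rewrite rev_cat rev_rcons => -[].
rewrite {t}t1 in u_neq0 pre0 pre1 pal.
have [v0 v0_eq v0_pre] := psi_prefix_rcons pre0.
rewrite v0_eq psi_prefix in pre1.
apply: (IH v0) => //; first by apply: contra_eq_neq v0_eq => ->; case: (u).
move: pal; rewrite v0_eq cat_cons -psi_cat rev_cons.
by rewrite -{1}[tail_y n ++ v0]revK -true_psi_rev => -[/psi_inj].
Qed.

(** * Back to the ternary alphabet *)

Definition code (t : bool) := if t then Lb else Lc.

Definition interleave (u : seq bool) : seq letter :=
  flatten [seq [:: La; code t] | t <- u].

Lemma interleave_cons t u : interleave (t :: u) = [:: La, code t & interleave u].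
Proof. by []. Qed.

Lemma interleave_cat u v : interleave (u ++ v) = interleave u ++ interleave v.
Proof. by rewrite /interleave map_cat flatten_cat. Qed.

Lemma prefix_interleave u v : prefix (interleave u) (interleave v) = prefix u v.
Proof.
by elim: u v => [|[] u IH] [|[] v]; rewrite ?interleave_cons ?prefix0s /= ?IH.
Qed.

Lemma interleave_inj : injective interleave.
Proof. by elim=> [|[] u IH] [|[] v] //= []// /IH ->. Qed.

(** The letter a occurs only at even positions, so [u] is made of whole pairs. *)
Lemma interleave_prefix_rcons u v : prefix (rcons u La) (interleave v) ->
  exists2 w, u = interleave w & prefix w v.
Proof.
elim: v u => [|t v IH] [|l [|l' u]] //; rewrite ?interleave_cons /=.
- by exists [::].
- by case: t => /andP[].
case/and3P=> /eqP-> /eqP-> /IH[w -> w_v].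
by exists (t :: w) => //=; rewrite eqxx.
Qed.

(** Reversal puts each a after its partner; one more a in front realigns the pairs. *)
Lemma interleave_rev u : La :: rev (interleave u) = rcons (interleave (rev u)) La.
Proof.
elim: u => // t u IH.
rewrite interleave_cons 2!rev_cons -rcons_cons -rcons_cons IH rev_cons.
by rewrite -[rcons (rev u) t]cats1 interleave_cat -!cats1 -!catA.
Qed.

(** Indeed gamma(ac) = acab and gamma(ab) = acacab. *)
Lemma gamma_interleave u : gamma (interleave u) = interleave (psi u).
Proof.
elim: u => // t u IH; rewrite psi_cons interleave_cat -IH interleave_cons.
by case: t.
Qed.

Lemma iter_gamma_interleave n u :
  iter n gamma (interleave u) = interleave (iter n psi u).
Proof. by elim: n => //= n ->; rewrite gamma_interleave. Qed.

Lemma iter_gamma_cat n u v : iter n gamma (u ++ v) = iter n gamma u ++ iter n gamma v.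
Proof. by elim: n => //= n ->; exact: (morphism_ofP _).2. Qed.

Definition prefix_x w := w = mkseq x_gamma (size w).

Lemma prefix_mkseq m n : m <= n -> prefix (mkseq x_gamma m) (mkseq x_gamma n).
Proof.
move=> le_mn; rewrite prefixE size_mkseq -map_take take_iota.
by rewrite (minn_idPl le_mn).
Qed.

Lemma prefix_xP w : prefix_x w <-> exists n, prefix w (iter n gamma [:: La]).
Proof.
have [N N_pre] := x_gammaP (size w); split=> [->|[n w_n]].
  by exists N; apply: N_pre.
have := N_pre (maxn n N) (leq_maxr _ _).
have w_pre := prefix_trans w_n (prefix_iter_gamma (leq_maxl n N)).
by move: w_pre; rewrite !prefixE size_mkseq => /eqP-> /eqP.
Qed.

Lemma prefix_x_prefix u v : prefix u v -> prefix_x v -> prefix_x u.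
Proof.
by move=> uv /prefix_xP[n vn]; apply/prefix_xP; exists n; exact: prefix_trans uv vn.
Qed.

Lemma prefix_x_interleave u : prefix_x (interleave u) <-> prefix_y u.
Proof.
split=> [/prefix_xP[n un]|[n un]].
  exists n; rewrite -prefix_interleave -iter_gamma_interleave.
  apply: prefix_trans un _.
  by rewrite -[interleave _]/([:: La] ++ [:: Lc]) iter_gamma_cat prefix_prefix.
(* The extra iteration comes from gamma(a) = aca, which starts with the spelling ac of c. *)
apply/prefix_xP; exists n.+1; rewrite iterSr.
apply: (@prefix_trans _ (interleave (iter n psi [:: false]))).
  by rewrite prefix_interleave.
rewrite -iter_gamma_interleave -[gamma _]/(interleave [:: false] ++ [:: La]).
by rewrite iter_gamma_cat prefix_prefix.
Qed.

Lemma prefix_x_rcons u : prefix_x (rcons u La) -> exists2 w, u = interleave w & prefix_y w.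
Proof.
move=> /prefix_xP[n un].
have {}un : prefix (rcons u La) (interleave (iter n psi [:: false])).
  apply: prefix_trans un _; rewrite -iter_gamma_interleave.
  by rewrite -[interleave _]/([:: La] ++ [:: Lc]) iter_gamma_cat prefix_prefix.
by have [w -> w_n] := interleave_prefix_rcons un; exists w => //; exists n.
Qed.

(** * Primitivity of gamma and palindromes in x *)

Lemma gamma_primitive : primitive gamma.
Proof. by exists 3 => -[] []. Qed.

Lemma x_gamma_palindromic : palindromic x_gamma.
Proof.
move=> n; have [w w_eq] : exists w, interleave (tail_y n.+1) = La :: w.
  by rewrite tail_yS interleave_cons; eexists.
have /prefix_x_interleave : prefix_y (iter n.+1 psi [:: false]).
  by exists n.+1; apply: prefix_refl.
rewrite iter_psi_false interleave_cons w_eq => Px.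
exists w; split.
(* The offset skips ac, which spells the first letter of y, and the a dropped from the spelling of
   [tail_y n.+1]. *)
- exists 3; apply: (@eq_from_nth _ La); first by rewrite size_mkseq.
  move=> i lt_i; rewrite nth_mkseq //.
  have /(congr1 (fun s => nth La s (3 + i))) := Px.
  by rewrite nth_mkseq.
- have := interleave_rev (tail_y n.+1); rewrite tail_y_palindrome w_eq rev_cons.
  by move=> [/rcons_inj[]].
have : size (interleave (tail_y n.+1)) = (size (tail_y n.+1)).*2.
  by elim: (tail_y _) => // t u IH; rewrite interleave_cons /= IH.
rewrite w_eq => /(congr1 predn) /= ->.
have := leq_size_tail_y n.+1; case: (size _) => // k le_nk.
by rewrite doubleS /= -addnn -addnS (leq_trans (le_nk : n <= k)) ?leq_addr.
Qed.

(** * Morphisms fixing x *)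

Section Stabilizer.

Variable phi : seq letter -> seq letter.
Hypotheses (phiM : is_morphism phi) (phi_x : image_infword phi x_gamma x_gamma).

Lemma prefix_x_fixed u : prefix_x u -> prefix_x (phi u).
Proof.
move=> u_eq; have [N N_pre] := phi_x (size (phi u)).
have := N_pre (maxn N (size u)) (leq_maxl _ _).
have /prefixP[s ->] := prefix_mkseq (leq_maxr N (size u)).
rewrite -u_eq phiM.2 => pre.
have : prefix (phi u) (phi u ++ phi s) by apply: prefix_prefix.
by move: pre; rewrite !prefixE size_mkseq => /eqP-> /eqP.
Qed.

Lemma phi_nonerasing_pair : phi [:: La; Lc] ++ phi [:: La; Lb] != [::].
Proof.
apply/eqP => /eqP; rewrite -size_eq0 size_cat addn_eq0 !size_eq0 => /andP[/eqP ac /eqP ab].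
have phi_cons l u : phi (l :: u) = phi [:: l] ++ phi u by rewrite -phiM.2.
have phi_l l : phi [:: l] = [::].
  move: ac ab; rewrite (phi_cons La [:: Lc]) (phi_cons La [:: Lb]).
  by case: l; case: (phi [:: La]); case: (phi [:: Lb]); case: (phi [:: Lc]).
have phi0 u : phi u = [::] by elim: u => [|l u IH]; rewrite ?phiM.1 // phi_cons phi_l IH.
by have [N /(_ N (leqnn N))] := phi_x 1; rewrite phi0.
Qed.

(** The word U V U U V is a prefix of x, with U = phi(ac) and V = phi(ab). If U is nonempty it
    starts with a, so U V and U V U are made of whole pairs; cancelling gives U, then V. If U is
    empty, V is followed by V, which starts with a. *)
Lemma phi_interleave_subst : exists w0 w1,
  phi [:: La; Lc] = interleave w0 /\ phi [:: La; Lb] = interleave w1.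
Proof.
have starts u s : prefix_x (phi u ++ s) -> phi u != [::] -> exists v, phi u = La :: v.
  case: (phi u) => // l v; rewrite /prefix_x cat_cons /= => -[-> _] _.
  by exists v.
have Px u : prefix_y u -> prefix_x (phi (interleave u)).
  by move=> /prefix_x_interleave/prefix_x_fixed.
have Py : prefix_y y5 by exists 2; apply: prefix_refl.
pose U := phi [:: La; Lc]; pose V := phi [:: La; Lb].
have phi_y5 : phi (interleave y5) = U ++ V ++ U ++ U ++ V.
  by rewrite /U /V -!phiM.2.
have {}Px := Px _ Py; rewrite phi_y5 in Px.
have [U_eq0|U_neq0] := eqVneq U [::].
  rewrite U_eq0 /= in Px.
  have V_neq0 : V != [::] by have := phi_nonerasing_pair; rewrite -/U -/V U_eq0.
  have [v v_eq] := starts [:: La; Lb] V Px V_neq0.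
  have [|w V_w _] := @prefix_x_rcons V.
    apply: prefix_x_prefix Px; rewrite -/V in v_eq.
    by rewrite -cats1 prefix_catr // eqxx {1}v_eq /= prefix0s.
  by exists [::], w.
have [v v_eq] := starts [:: La; Lc] _ Px U_neq0; rewrite -/U in v_eq.
have [|w1 w1_eq Pw1] := @prefix_x_rcons (U ++ V).
  apply: prefix_x_prefix Px; rewrite -cats1 -catA !prefix_catr // !eqxx.
  by rewrite {1}v_eq /= prefix0s.
have [|w2 w2_eq Pw2] := @prefix_x_rcons (U ++ V ++ U).
  apply: prefix_x_prefix Px; rewrite -cats1 -!catA !prefix_catr // !eqxx.
  by rewrite {1}v_eq /= prefix0s.
have cancel s t v' : interleave s ++ v' = interleave t -> exists z, v' = interleave z.
  move=> st; have /prefixP[z t_eq] : prefix s t.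
    by rewrite -prefix_interleave -st prefix_prefix.
  exists z; move: st; rewrite t_eq interleave_cat => /eqP.
  by rewrite eqseq_cat // eqxx => /eqP.
have [w0 w0_eq] : exists z, U = interleave z.
  by apply: (cancel w1 w2); rewrite -w1_eq -w2_eq catA.
have [z z_eq] : exists z, V = interleave z.
  by apply: (cancel w0 w1); rewrite -w1_eq w0_eq.
by exists w0, z.
Qed.

Lemma phi_interleave_iter : exists n,
  phi [:: La; Lc] = interleave (iter n psi [:: false]) /\
  phi [:: La; Lb] = interleave (iter n psi [:: true]).
Proof.
have [w0 [w1 [ac ab]]] := phi_interleave_subst.
have phi_subst u : phi (interleave u) = interleave (subst w0 w1 u).
  elim: u => [|t u IH]; first exact: phiM.1.
  rewrite subst_cons interleave_cat -IH.
  rewrite -[interleave (t :: u)]/([:: La; code t] ++ interleave u) phiM.2.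
  by case: t; rewrite ?ac ?ab.
have [||n [w0_eq w1_eq]] := @y_stabilizer w0 w1; last by exists n; rewrite -w0_eq -w1_eq.
  move=> u /prefix_x_interleave/prefix_x_fixed; rewrite phi_subst.
  by move/prefix_x_interleave.
by have := phi_nonerasing_pair; rewrite ac ab; case: (w0); case: (w1).
Qed.

End Stabilizer.

(** Conjugate images are rearrangements of each other; both their lengths and their numbers of a get
    compared. *)
Lemma conjugate_count (T : eqType) (phi phi' : seq T -> seq T) (P : pred T) u :
  conjugate phi phi' -> count P (phi u) = count P (phi' u).
Proof.
by case=> [[w wE]|[w wE]]; have /(congr1 (count P)) := wE u;
  rewrite !count_cat addnC => /addnI.
Qed.

Lemma interleave_prefix_code u t v : prefix (rcons u (code t)) (interleave v) ->
  exists2 w, rcons u (code t) = interleave w & prefix w v.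
Proof.
elim: v u => [|t' v IH] [|l [|l' u]] //; rewrite ?interleave_cons /=.
- by case: t {IH}.
- by case: t {IH}; case: t' => /and3P[/eqP-> /eqP]// _ _;
    [exists [:: true]|exists [:: false]]; rewrite /= ?prefix0s.
case/and3P=> /eqP-> /eqP-> /IH[w -> w_v].
by exists (t' :: w) => //=; rewrite eqxx.
Qed.

(** * Words conjugating a morphism that fixes x to its reversal *)

Section ClassP.

(** [U], [V0], [V1] stand for phi(a), phi(c), phi(b); the cut after [U] is arbitrary. *)
Variables (n : nat) (U V0 V1 D : seq letter).
Hypothesis UV0 : U ++ V0 = interleave (iter n psi [:: false]).
Hypothesis UV1 : U ++ V1 = interleave (iter n psi [:: true]).
Hypothesis D_eq : interleave (tail_y n) = La :: D.

Let UV_ncomm : (U ++ V0) ++ (U ++ V1) <> (U ++ V1) ++ (U ++ V0).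
Proof.
rewrite UV0 UV1 -!interleave_cat -!iter_psi_cat.
by move=> /interleave_inj/iter_psi_inj.
Qed.

Let D_conj u : D ++ interleave (iter n psi u) =
  rev (interleave (iter n psi (rev u))) ++ D.
Proof.
have /(congr1 interleave) := tail_y_conj n u; rewrite !interleave_cat D_eq.
by rewrite -cat_rcons -interleave_rev => -[].
Qed.

Let D_palindrome : rev D = D.
Proof.
have := interleave_rev (tail_y n); rewrite tail_y_palindrome D_eq rev_cons.
by move=> [/rcons_inj[]].
Qed.

(** A word conjugating each letter image to its reversal takes [U ++ V] to [rev U ++ rev V], while
    [D] takes it to [rev V ++ rev U]. Prepending [rev U] to [D] makes the two comparable. *)
Let T_conj V : D ++ U ++ V = rev (U ++ V) ++ D ->
  (rev U ++ D) ++ (U ++ V) = (rev U ++ rev V) ++ (rev U ++ D).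
Proof. by move=> DUV; rewrite -catA DUV rev_cat -!catA. Qed.

Let T_conj0 : (rev U ++ D) ++ (U ++ V0) = (rev U ++ rev V0) ++ (rev U ++ D).
Proof. by apply: T_conj; rewrite UV0; exact: D_conj [:: false]. Qed.

Let T_conj1 : (rev U ++ D) ++ (U ++ V1) = (rev U ++ rev V1) ++ (rev U ++ D).
Proof. by apply: T_conj; rewrite UV1; exact: D_conj [:: true]. Qed.

Let D_head : exists D', D = Lb :: D'.
Proof.
(* [D_eq] excludes [n] = 0, where [tail_y] is empty. *)
case: n D_eq => // m; rewrite tail_yS interleave_cons => -[<-].
by eexists.
Qed.

(** The nonempty word [T ++ W] would commute with both [rev U ++ rev V0] and [rev U ++ rev V1];
    these would commute with each other, and so would [U ++ V0] and [U ++ V1]. *)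
Lemma no_right_conjugator W : U ++ W = W ++ rev U ->
  V0 ++ W = W ++ rev V0 -> V1 ++ W = W ++ rev V1 -> False.
Proof.
move=> UW V0W V1W; set T := rev U ++ D.
have comm V : V ++ W = W ++ rev V -> T ++ (U ++ V) = (rev U ++ rev V) ++ T ->
    (T ++ W) ++ (rev U ++ rev V) = (rev U ++ rev V) ++ (T ++ W).
  by move=> VW TUV; rewrite [RHS]catA -TUV -!catA VW (catA U) UW -!catA.
have TW_neq0 : T ++ W != [::].
  by have [D' D'_eq] := D_head; rewrite /T D'_eq; case: (rev U).
have y_comm := commute_trans TW_neq0 (comm _ V0W T_conj0) (comm _ V1W T_conj1).
apply: UV_ncomm; have : T ++ ((U ++ V0) ++ (U ++ V1)) = T ++ ((U ++ V1) ++ (U ++ V0)).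
  rewrite catA T_conj0 -(catA _ T) T_conj1 (catA _ _ T) y_comm -(catA _ _ T).
  by rewrite -T_conj0 catA -T_conj1 -catA.
by move/eqP; rewrite eqseq_cat // eqxx => /eqP.
Qed.

Lemma left_conjugator_unique W : W ++ U = rev U ++ W ->
  W ++ V0 = rev V0 ++ W -> W ++ V1 = rev V1 ++ W -> W = rev U ++ D.
Proof.
move=> WU WV0 WV1.
have comm V : W ++ V = rev V ++ W -> W ++ (U ++ V) = (rev U ++ rev V) ++ W.
  by move=> WV; rewrite catA WU -!catA WV.
apply: (conjugator_unique _ (comm _ WV0) T_conj0 (comm _ WV1) T_conj1 UV_ncomm).
rewrite -size_eq0 size_cat !size_rev -size_cat UV0 iter_psi_false.
by rewrite interleave_cons.
Qed.

(** As [W] is [rev U ++ D], its symmetry reads D U = rev(U) D. A nonempty [U] then ends in b like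
    [rev D], hence spells a word [u] making [tail_y n ++ u] a palindrome. Otherwise [W] is [D], of
    odd length. *)
Lemma left_conjugator_odd W : palindrome W -> W ++ U = rev U ++ W ->
  W ++ V0 = rev V0 ++ W -> W ++ V1 = rev V1 ++ W -> U = [::] /\ odd (size W).
Proof.
rewrite /palindrome => W_pal WU WV0 WV1.
have W_eq := left_conjugator_unique WU WV0 WV1.
have DU : D ++ U = rev U ++ D.
  by move: W_pal; rewrite W_eq rev_cat revK D_palindrome.
case/lastP: (U) W_eq DU UV0 UV1 => [|U' l] W_eq DU UV0' UV1'.
  split=> //; rewrite W_eq /=.
  have : odd (size (interleave (tail_y n))) = false.
    by elim: (tail_y n) => // t u IH; rewrite interleave_cons /= IH.
  by rewrite D_eq /= => /negbFE.
have [D' D'_eq] := D_head.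
have l_eq : l = code true by move: DU; rewrite D'_eq rev_rcons => -[].
rewrite l_eq in DU UV0' UV1'.
have := prefix_prefix (rcons U' (code true)) V0; rewrite UV0'.
move=> /interleave_prefix_code[u u_eq u_pre0].
have := prefix_prefix (rcons U' (code true)) V1; rewrite UV1' u_eq prefix_interleave.
move=> u_pre1.
case: (@tail_y_cat_not_palindrome n u _ u_pre0 u_pre1).
  by apply: contra_eq_neq u_eq => ->; case: (U').
(* The appended a allows [interleave_rev] to pass from the reversal of the binary word to that of
   its spelling. *)
apply: interleave_inj; apply: (@rcons_injl _ La).
rewrite -interleave_rev interleave_cat D_eq -u_eq cat_cons rev_cons rev_cat.
by rewrite D_palindrome DU.
Qed.

End ClassP.

(** * Excluding conjugates in class P *)

Theorem mainTheorem1 :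
  [/\ primitive gamma,
      palindromic x_gamma
    & forall phi : seq letter -> seq letter,
        is_morphism phi ->
        image_infword phi x_gamma x_gamma ->
        ~ (phi =1 id) ->
        ~ has_conjugate_in_classP phi].
Proof.
split; [exact: gamma_primitive|exact: x_gamma_palindromic|].
move=> phi phiM phi_x phi_neq_id [psi' [psi'M [p p_pal psi'_pq]] conj].
have [n [ac ab]] := phi_interleave_iter phiM phi_x.
have phi_cons l u : phi (l :: u) = phi [:: l] ++ phi u by rewrite -phiM.2.
rewrite phi_cons in ac; rewrite phi_cons in ab.
have phi_nonerasing : exists l, phi [:: l] != [::].
  have := phi_nonerasing_pair phiM phi_x.
  rewrite (phi_cons La [:: Lc]) (phi_cons La [:: Lb]).
  case U_eq: (phi [:: La]) => [|l u]; last by exists La; rewrite U_eq.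
  case V0_eq: (phi [:: Lc]) => [|l u]; last by exists Lc; rewrite V0_eq.
  by exists Lb.
have size_conj u : size (psi' u) = size (phi u).
  by rewrite -!count_predT (conjugate_count _ _ conj).
have p_nil : phi [:: La] = [::] -> p = [::].
  move=> a_eq0; have [q _ a_eq] := psi'_pq La.
  by have := size_conj [:: La]; rewrite a_eq0 a_eq; case: (p).
(* For [n] = 0, phi(a) is empty or a. If empty, phi(c) = ac, and the image of c under [psi'] would
   be a palindrome of length 2 with exactly one a; otherwise [phi] is the identity. *)
case: n ac ab => [|n] ac ab.
  have [a_eq0|a_eq] : phi [:: La] = [::] \/ phi [:: La] = [:: La].
    move: ac ab; case: (phi [:: La]) => [|[] [|l u]] //=; first by left.
      by right.
    by move=> [->].
  - have [q q_pal] := psi'_pq Lc; rewrite (p_nil a_eq0) /= => c_eq.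
    rewrite a_eq0 /= in ac.
    have := size_conj [:: Lc]; have := conjugate_count (pred1 La) [:: Lc] conj.
    rewrite ac c_eq; move: q_pal; rewrite /palindrome.
    by case: (q) => [|l1 [|l2 [|]]] //= [->]; case: l1 {ac c_eq}.
  apply: phi_neq_id; elim=> [|l u IH]; first exact: phiM.1.
  rewrite phi_cons IH /=; move: ac ab; rewrite a_eq => -[ac] [ab].
  by case: l; rewrite ?a_eq ?ac ?ab.
have [D D_eq] : exists D, interleave (tail_y n.+1) = La :: D.
  by rewrite tail_yS interleave_cons; eexists.
have [W [W_pal W_odd]] := classP_conjugate_rev psi'M p_pal psi'_pq conj phi_nonerasing.
case=> WE; first exact: (no_right_conjugator ac ab D_eq (WE La) (WE Lc) (WE Lb)).
have [a_eq0] := left_conjugator_odd ac ab D_eq W_pal (WE La) (WE Lc) (WE Lb).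
(* Parity clash: [W] has odd length, but phi(a) empty makes [p] empty. *)
by rewrite W_odd p_nil.
Qed.
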